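(* Let $x\in\mathbb{R}$. For any sequence $\{q_n\}_{n\ge 1}$ of positive real numbers, the inequality $$q_n p_{n+1}^{x}-q_{n+1}p_{n}^{x}<\frac{p_{n}^{x}}{p_{n+1}^{1-x}}$$ holds for infinitely many positive integers $n$.
   Context: For each positive integer $n$, $p_n$ denotes the $n$th prime number. *)

(* Defs.v *)
From mathcomp Require Import all_boot.

Set Implicit Arguments.
Unset Strict Implicit.
Unset Printing Implicit Defensive.

Lemma ex_prime_above (m : nat) : exists p, (m < p) && prime p.
Proof. by have [p mp pp] := prime_above m; exists p; rewrite mp. Qed.

Definition next_prime (m : nat) : nat := ex_minn (ex_prime_above m).

(* Indexed from 1: [nth_prime 1 = 2], [nth_prime 2 = 3].  The value
   [nth_prime 0 = 0] is only the seed of the iteration. *)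
Definition nth_prime (n : nat) : nat := iter n next_prime 0.

Lemma nth_primeS (n : nat) : nth_prime n.+1 = next_prime (nth_prime n).
Proof. by []. Qed.

Lemma prime_nth_prime (n : nat) : 0 < n -> prime (nth_prime n).
Proof.
by case: n => // n _; rewrite nth_primeS /next_prime; case: ex_minnP => p /andP[].
Qed.

Lemma nth_prime_ltS (n : nat) : nth_prime n < nth_prime n.+1.
Proof. by rewrite nth_primeS /next_prime; case: ex_minnP => p /andP[]. Qed.

Lemma nth_prime_onto (p : nat) :
  prime p -> exists2 n, 0 < n & nth_prime n = p.
Proof.
move=> pp.
have le_id n : n <= nth_prime n.
  by elim: n => // n IHn; apply: leq_ltn_trans IHn (nth_prime_ltS n).
have [n pn nmin] := ex_minnP (ex_intro (fun n => p <= nth_prime n) p (le_id p)).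
case: n pn nmin => [|n] pn nmin; first by move: pp; case: p pn {nmin le_id}.
exists n.+1 => //; apply/eqP; rewrite eqn_leq pn andbT.
have np : nth_prime n < p.
  by rewrite ltnNge; apply/negP => /nmin; rewrite ltnn.
by rewrite nth_primeS /next_prime; case: ex_minnP => r _; apply; rewrite np.
Qed.

(* Main.v *)
Require Import Defs.
From mathcomp Require Import all_boot all_order all_algebra.
From mathcomp Require Import classical_sets cardinality reals exp.
From mathcomp Require Import boolp sequences.
From mathcomp Require Import ring lra.

Set Implicit Arguments.
Unset Strict Implicit.
Unset Printing Implicit Defensive.

Import Order.TTheory GRing.Theory Num.Theory.
Local Open Scope classical_set_scope.
Local Open Scope ring_scope.

(** Dividing by [p_n^x * p_{n+1}^x] turns the inequality into
    [a_n - a_{n+1} < 1 / p_{n+1}] with [a_n = q_n / p_n^x > 0].  If it failed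
    from some index on, the drops of the positive sequence [a] would telescope
    to a bound on the partial sums of [\sum 1 / p_n], whereas this series
    diverges; this is [pos_drop_lt_infinitely_often].

    The divergence is Euler's theorem.  Every [n] between [1] and [N] has all
    its prime factors among the first [N] primes, so that the harmonic sum up
    to [N] is at most the Euler product [\prod (1 - 1/p)^-1] over these primes
    ([sum_recip_smooth_le]).  Each factor is at most [expR (2 / p)], hence the
    harmonic sum is at most [expR (2 * \sum 1/p)]
    ([harmonic_le_sum_recip_primes]), and bounded sums of prime reciprocals
    would make the harmonic series converge.

    The Euler product is bounded without expanding geometric series, by
    induction on the list of primes: if [S] is the sum of the reciprocals of the
    integers up to [N] with prime factors in [p :: s], and [S'] the same sum
    for [s], then the multiples of [p] contribute at most [S / p] to [S] and
    the other integers at most [S'], so that [S * (1 - 1/p) <= S']. *)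

(** * Reciprocal sums over smooth integers *)

(** [0] is not smooth, so the sums below may range from [0] although [0^-1] is
    not a meaningful reciprocal. *)
Definition smooth (s : seq nat) (n : nat) : bool := [pred p in s].-nat n.

Lemma smooth_nil (n : nat) : smooth [::] n -> n = 1%N.
Proof.
case/andP=> n_gt0 /allP n1; apply/eqP; apply: contraT => n_neq1.
have n_gt1 : (1 < n)%N by rewrite ltn_neqAle eq_sym n_neq1.
by have /n1 : pdiv n \in primes n by rewrite mem_primes pdiv_prime // n_gt0 pdiv_dvd.
Qed.

Lemma smooth_cons_coprime (p : nat) (s : seq nat) (n : nat) :
  ~~ (p %| n)%N -> smooth (p :: s) n -> smooth s n.
Proof.
move=> pNn /pnatP h; have n_gt0 : (0 < n)%N by case: n pNn {h}; rewrite ?dvdn0.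
apply/pnatP => // r r_pr rn; have := h n_gt0 r r_pr rn.
by rewrite !inE => /orP[/eqP rp|//]; rewrite -rp rn in pNn.
Qed.

(** Writing a multiple of [p] as [p * j] factors [1/p] out of the sum and leaves
    an integer [j <= N] with the same allowed prime factors. *)
Lemma sum_recip_multiples (R : realType) (p : nat) (s : seq nat) (N : nat) :
  prime p ->
  \sum_(i < N.+1 | smooth s i && (p %| i)%N) (i%:R : R)^-1
    <= p%:R^-1 * \sum_(i < N.+1 | smooth s i) (i%:R : R)^-1.
Proof.
move=> p_pr; have p_gt0 := prime_gt0 p_pr.
(* [inord] sends products exceeding [N] to [0], which is not smooth. *)
rewrite (reindex_onto (fun j : 'I_N.+1 => inord (p * j) : 'I_N.+1)
                      (fun i : 'I_N.+1 => inord (i %/ p) : 'I_N.+1)) /=; last first.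
  move=> i /andP[_ pi]; apply: val_inj => /=.
  rewrite !inordK ?muln_divA ?mulKn //.
    by rewrite ltnS (leq_trans (leq_div _ _)) // -ltnS.
  by rewrite ltnS (leq_trans (leq_div _ _)) // -ltnS.
rewrite mulr_sumr big_mkcond [leRHS]big_mkcond /=; apply: ler_sum => j _.
have [pjN|pjN] := ltnP (p * j) N.+1; last first.
  have -> : (inord (p * j) : 'I_N.+1) = ord0.
    by apply: val_inj; rewrite /inord val_insubd ltnNge pjN.
  rewrite /smooth [_.-nat _]/pnat ltnn /=.
  by case: ifP => // _; rewrite mulr_ge0 ?invr_ge0.
rewrite inordK //; case: ifP => [/andP[/andP[spj _] _]|_].
  move: spj; rewrite /smooth pnatM => /andP[_ ->].
  by rewrite natrM invfM.
by case: ifP => // _; rewrite mulr_ge0 ?invr_ge0.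
Qed.

(** One half of Euler's product formula, truncated at [N].  In the induction
    step the sum for [p :: s] occurs on both sides: its multiples of [p] give
    back at most [1/p] times the sum itself, and one solves for it. *)
Lemma sum_recip_smooth_le (R : realType) (s : seq nat) (N : nat) :
  all prime s ->
  \sum_(i < N.+1 | smooth s i) (i%:R : R)^-1
    <= \prod_(p <- s) (1 - (p%:R : R)^-1)^-1.
Proof.
elim: s => [|p s IHs] /= => [_|/andP[p_pr s_pr]].
  rewrite big_nil (@le_trans _ _ (\sum_(i < N.+1 | i == 1%N :> nat) 1)) //.
    rewrite big_mkcond [leRHS]big_mkcond; apply: ler_sum => i _.
    case: ifP => [/smooth_nil ->|_]; last by case: ifP.
    by rewrite eqxx invr1.
  case: N => [|N]; first by rewrite big1 // => i; rewrite ord1.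
  by rewrite (big_pred1 (inord 1)) // => i; rewrite /= -val_eqE /= inordK.
have p1 : 0 < 1 - (p%:R : R)^-1.
  by rewrite subr_gt0 invf_lt1 ?ltr1n ?ltr0n ?prime_gt0 ?prime_gt1.
rewrite big_cons mulrC ler_pdivlMr // mulrBr mulr1 lerBlDr.
rewrite [leLHS](bigID (fun i : 'I_N.+1 => (p %| i)%N)) /= addrC.
apply: lerD; last by rewrite [leRHS]mulrC; exact: sum_recip_multiples.
apply: le_trans (IHs s_pr); rewrite big_mkcond [leRHS]big_mkcond /=.
apply: ler_sum => i _; case: ifP => [/andP[spi pNi]|_].
  by rewrite (smooth_cons_coprime pNi spi).
by case: ifP => // _; rewrite invr_ge0.
Qed.

(** For [u = 1/p <= 1/2] one has [(1 - u)^-1 <= 1 + 2 u], because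
    [(1 + 2 u) (1 - u) - 1 = u (1 - 2 u)] is nonnegative. *)
Lemma inv_1Bprime_le_expR (R : realType) (p : nat) : prime p ->
  (1 - (p%:R : R)^-1)^-1 <= expR (2 * p%:R^-1).
Proof.
move=> p_pr; apply: le_trans (expR_ge1Dx _).
have p_gt0 : 0 < (p%:R : R) by rewrite ltr0n prime_gt0.
have u_gt0 : 0 < (p%:R : R)^-1 by rewrite invr_gt0.
have u_le : (p%:R : R)^-1 <= 2^-1 by rewrite lef_pV2 ?posrE // ler_nat prime_gt1.
set u : R := p%:R^-1 in u_gt0 u_le *.
have u2 : u * 2 <= 1 by rewrite -ler_pdivlMr ?mul1r.
have u1 : 0 < 1 - u by rewrite subr_gt0 (le_lt_trans u_le) // invf_lt1 ?ltr1n.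
rewrite -[leLHS]mul1r ler_pdivrMr //; nra.
Qed.

(** * Divergence of the sum of prime reciprocals *)

Lemma leq_nth_prime (n : nat) : (n <= nth_prime n)%N.
Proof. by elim: n => // n IHn; apply: leq_ltn_trans IHn (nth_prime_ltS n). Qed.

(** As [i <= nth_prime i], the first [N] primes include every prime up to [N],
    so all the integers from [1] to [N] are smooth over them. *)
Lemma harmonic_le_sum_recip_primes (R : realType) (N : nat) :
  series (@harmonic R) N
    <= expR (2 * \sum_(1 <= i < N.+1) ((nth_prime i)%:R : R)^-1).
Proof.
pose s := [seq nth_prime i | i <- index_iota 1 N.+1].
have s_pr : all prime s.
  apply/allP => p /mapP[i]; rewrite mem_index_iota => /andP[i_gt0 _] ->.
  exact: prime_nth_prime.
have smoothN n : (0 < n <= N)%N -> smooth s n.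
  case/andP=> n_gt0 nN; apply/pnatP => // p p_pr pn.
  have [i i_gt0 pi] := nth_prime_onto p_pr.
  rewrite inE -pi map_f // mem_index_iota i_gt0 ltnS.
  rewrite (leq_trans (leq_nth_prime i)) //.
  by rewrite pi (leq_trans _ nN) // dvdn_leq.
have -> : series (@harmonic R) N
    = \sum_(i < N.+1 | smooth s i) (i%:R : R)^-1.
  rewrite big_mkcond big_ord_recl /= /series /= big_mkord add0r.
  by apply: eq_bigr => i _; rewrite smoothN //= /bump /= add1n.
apply: le_trans (sum_recip_smooth_le R N s_pr) _.
rewrite mulr_sumr expR_sum big_map big_seq [leRHS]big_seq.
apply: ler_prod => i; rewrite mem_index_iota => /andP[i_gt0 _].
rewrite inv_1Bprime_le_expR ?prime_nth_prime // andbT invr_ge0 subr_ge0.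
by rewrite invf_le1 ?ler1n ?ltr0n prime_gt0 ?prime_nth_prime.
Qed.

Lemma sum_recip_primes_unbounded (R : realType) (B : R) :
  exists N, B < \sum_(1 <= i < N.+1) ((nth_prime i)%:R : R)^-1.
Proof.
apply: contrapT => /forallNP bounded; apply: (@dvg_harmonic R).
apply: nondecreasing_is_cvgn.
  apply/nondecreasing_seqP => n.
  by rewrite /series /= big_nat_recr //= lerDl invr_ge0.
exists (expR (2 * B)) => _ [N _ <-].
apply: le_trans (harmonic_le_sum_recip_primes R N) _.
by rewrite ler_expR ler_pM2l // leNgt; apply/negP/bounded.
Qed.

(** * Drops of a positive sequence *)

(** Drops [a n - a n.+1 >= d n.+1] from some [M] on would sum to at most [a M],
    since [a] stays positive, and so bound the partial sums of [d]. *)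
Lemma pos_drop_lt_infinitely_often (R : realType) (a d : nat -> R) :
  (forall n, (0 < n)%N -> 0 < a n) ->
  (forall n, 0 <= d n) ->
  (forall B, exists N, B < \sum_(1 <= i < N.+1) d i) ->
  infinite_set [set n : nat | (0 < n)%N /\ a n - a n.+1 < d n.+1].
Proof.
move=> a_gt0 d_ge0 d_unbounded /finite_seqP[s sE].
pose M := (\max_(i <- s) i).+1.
have M_drop n : (M <= n)%N -> d n.+1 <= a n - a n.+1.
  move=> Mn; rewrite leNgt; apply/negP => lt_d.
  have : [set` s] n by rewrite -sE; split=> //; apply: leq_trans Mn.
  move=> /= ns; have := @leq_bigmax_seq _ s xpredT id n ns isT.
  by rewrite leqNgt Mn.
have partial_le k : \sum_(1 <= i < (M + k).+1) d i
    <= \sum_(1 <= i < M.+1) d i + a M - a (M + k)%N.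
  elim: k => [|k IHk]; first by rewrite addn0 addrK.
  rewrite addnS big_nat_recr //=.
  apply: le_trans (lerD IHk (M_drop (M + k)%N (leq_addr _ _))) _.
  by rewrite addrA subrK.
have [N] := d_unbounded (\sum_(1 <= i < M.+1) d i + a M); apply/negP; rewrite -leNgt.
apply: le_trans (le_trans (partial_le N) _); last first.
  by rewrite gerBl ltW // a_gt0 // addSn.
rewrite [leRHS](@big_cat_nat _ _ _ N.+1) //= ?ltnS ?leq_addl //.
by rewrite lerDl sumr_ge0.
Qed.

(** * The inequality for primes *)

Theorem theorem1p1 (R : realType) (x : R) (q : nat -> R)
    (q_gt0 : forall n : nat, (0 < n)%N -> 0 < q n) :
  infinite_set [set n : nat | (0 < n)%N /\
    q n * (nth_prime n.+1)%:R `^ x - q n.+1 * (nth_prime n)%:R `^ x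
      < (nth_prime n)%:R `^ x / (nth_prime n.+1)%:R `^ (1 - x)].
Proof.
pose pr n : R := (nth_prime n)%:R.
have pr_gt0 n : (0 < n)%N -> 0 < pr n.
  by move=> n_gt0; rewrite ltr0n prime_gt0 ?prime_nth_prime.
pose a n := q n / pr n `^ x.
have normalize n : (0 < n)%N ->
    (q n * pr n.+1 `^ x - q n.+1 * pr n `^ x < pr n `^ x / pr n.+1 `^ (1 - x))
    = (a n - a n.+1 < (pr n.+1)^-1).
  move=> n_gt0; have p_gt0 := pr_gt0 n.+1 isT.
  have u_gt0 := powR_gt0 x (pr_gt0 n n_gt0).
  have v_gt0 := powR_gt0 x p_gt0.
  rewrite powRB ?(gt_eqF p_gt0) ?implybT // powRr1 1?ltW //.
  rewrite /a; set u := pr n `^ x in u_gt0 *; set v := pr n.+1 `^ x in v_gt0 *.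
  rewrite -[RHS](ltr_pM2r (mulr_gt0 u_gt0 v_gt0)).
  by congr (_ < _); field; rewrite !gt_eqF.
have -> : [set n : nat | (0 < n)%N /\
    q n * pr n.+1 `^ x - q n.+1 * pr n `^ x < pr n `^ x / pr n.+1 `^ (1 - x)]
  = [set n : nat | (0 < n)%N /\ a n - a n.+1 < (pr n.+1)^-1].
  by apply/seteqP; split=> n /= [n_gt0]; rewrite normalize.
apply: (@pos_drop_lt_infinitely_often _ a (fun n => (pr n)^-1)) => [n n_gt0|n|B].
- by rewrite divr_gt0 ?q_gt0 ?powR_gt0 ?pr_gt0.
- by rewrite invr_ge0 ler0n.
- exact: sum_recip_primes_unbounded.
Qed.
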